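(* Let $K$ be an algebraically closed field of characteristic zero and let $A$ be a generalized block-triangular algebra over $K$. Then an element $a \in A$ is a commutator in $A$ (that is, $a = xy - yx$ for some $x, y \in A$) if and only if $a$ has multitrace zero.
   Context: Algebras are associative and unital. Let $K$ be an algebraically closed field of characteristic zero and let $A$ be a finite-dimensional unital associative $K$-algebra with Jacobson radical $\operatorname{rad}(A)$. By the Wedderburn-Malcev theorem there is a semisimple subalgebra $B$ of $A$ with $A = B \oplus \operatorname{rad}(A)$ (direct sum of vector spaces), and there is an algebra isomorphism $B \simeq M_{d_1}(K) \oplus \cdots \oplus M_{d_r}(K)$ with $d_1,\dots,d_r \geq 1$. One has $1_A = 1_B$. Multitrace: write $a \in A$ as $a = b + j$ with $b \in B$, $j \in \operatorname{rad}(A)$, and let $(b_1,\dots,b_r) \in M_{d_1}(K) \oplus \cdots \oplus M_{d_r}(K)$ be the image of $b$ under the isomorphism. The multitrace of $a$ is the multiset $\operatorname{mtr}(a) = \{\operatorname{tr}(b_1),\dots,\operatorname{tr}(b_r)\}$, and $a$ has multitrace zero if $\operatorname{tr}(b_i) = 0$ for all $i = 1,\dots,r$. (This does not depend on the choice of $B$ or of the isomorphism.) Generalized block-triangular algebra: let $e_i \in B$ be the element corresponding to the identity matrix of $M_{d_i}(K)$, so that $1_A = e_1 + \cdots + e_r$ with the $e_i$ orthogonal idempotents, and set $\operatorname{rad}(A)_{ij} = e_i \operatorname{rad}(A) e_j$. The algebra $A$ is called a generalized block-triangular algebra if, for some such decomposition and some numbering of the simple components of $B$, $\operatorname{rad}(A)_{ij}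 = 0$ for all $i \geq j$. *)

(* Defs.v *)
From HB Require Import structures.
From mathcomp Require Import all_boot all_algebra all_field.
From mathcomp Require Import boolp.

Set Implicit Arguments.
Unset Strict Implicit.
Unset Printing Implicit Defensive.

Import GRing.Theory.

Local Open Scope ring_scope.

Section JacobsonRadical.
Variables (K : fieldType) (A : falgType K).

(* Every left ideal of a unital K-algebra is a K-subspace, so quantifying over
   {vspace A} loses no ideal. *)
Definition left_ideal (M : {vspace A}) : Prop := (fullv * M <= M)%VS.

Definition maximal_left_ideal (M : {vspace A}) : Prop :=
  [/\ left_ideal M, M <> fullv
    & forall N : {vspace A}, left_ideal N -> (M <= N)%VS ->
        N = M \/ N = fullv].

Lemma jrad_exists : exists J : {vspace A}, forall x : A,
  x \in J <-> (forall M : {vspace A}, maximal_left_ideal M -> x \in M).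
Proof.
pose cap (s : seq {vspace A}) := (\bigcap_(M <- s) M)%VS.
pose maxs (s : seq {vspace A}) :=
  forall M : {vspace A}, M \in s -> maximal_left_ideal M.
pose P (n : nat) := exists2 s, maxs s & \dim (cap s) = n.
have exP : exists n, `[< P n >].
  by exists (\dim (cap [::])); apply/asboolP; exists [::].
case: (ex_minnP exP) => n /asboolP[s maxS dims] minn.
exists (cap s) => x; split=> [xs M maxM | xM]; last first.
  rewrite /cap big_seq; elim/big_ind: _ => [|U V xU xV|M /maxS/xM //].
    exact: memvf.
  by rewrite memv_cap xU.
have capM : cap (M :: s) = (M :&: cap s)%VS by rewrite /cap big_cons.
have le_n : (n <= \dim (cap (M :: s)))%N.
  apply: minn; apply/asboolP; exists (M :: s) => // N.
  by rewrite in_cons => /predU1P[-> // | /maxS].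
have /eqP eqC : (M :&: cap s == cap s)%VS.
  by rewrite eqEdim capvSr dims -capM.
by move: xs; rewrite -eqC memv_cap => /andP[].
Qed.

(* The intersection of all maximal left ideals, packaged as a subspace. *)
Definition jrad : {vspace A} := sval (cid jrad_exists).

Lemma jradP (x : A) :
  x \in jrad <-> (forall M : {vspace A}, maximal_left_ideal M -> x \in M).
Proof. exact: (svalP (cid jrad_exists)). Qed.

End JacobsonRadical.

Arguments jrad {K} A.

(* A decomposition A = B (+) rad(A) together with an algebra isomorphism
   B ~ M_(d_0)(K) (+) ... (+) M_(d_(r-1))(K) and a numbering of its simple
   components. As the operations of a direct sum are componentwise, the
   isomorphism is given by its components, one algebra morphism per block, and
   by a two-sided inverse of their joint map. *)
Record wedderburn_malcev (K : fieldType) (A : falgType K) := WedderburnMalcev {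
  wm_B : {aspace A};
  wm_B1 : 1 \in wm_B;
  wm_direct : directv (wm_B + jrad A)%VS;
  wm_full : (wm_B + jrad A = fullv)%VS;
  wm_r : nat;
  wm_d : 'I_wm_r -> nat;
  wm_d_gt0 : forall i, (0 < wm_d i)%N;
  wm_iso : forall i, {lrmorphism subvs_of wm_B -> 'M[K]_(wm_d i)};
  wm_inv : {dffun forall i, 'M[K]_(wm_d i)} -> subvs_of wm_B;
  wm_isoK : forall b : subvs_of wm_B, wm_inv [ffun i => wm_iso i b] = b;
  wm_invK : forall m i, wm_iso i (wm_inv m) = m i
}.

Section Decomposition.
Variables (K : fieldType) (A : falgType K) (D : wedderburn_malcev A).

Definition wm_component (a : A) : subvs_of (wm_B D) :=
  vsproj (wm_B D) (daddv_pi (wm_B D) (jrad A) a).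

Definition multitrace (a : A) (i : 'I_(wm_r D)) : K :=
  \tr (wm_iso i (wm_component a)).

Definition multitrace_zero (a : A) : Prop := forall i, multitrace a i = 0.

Definition wm_idem (i : 'I_(wm_r D)) : A :=
  vsval (wm_inv [ffun j => (j == i)%:R%:M]).

Definition jrad_block (i j : 'I_(wm_r D)) : {vspace A} :=
  (<[wm_idem i]> * jrad A * <[wm_idem j]>)%VS.

End Decomposition.

Definition generalized_block_triangular (K : fieldType) (A : falgType K) : Prop :=
  exists D : wedderburn_malcev A,
    forall i j : 'I_(wm_r D), (j <= i)%N -> jrad_block i j = 0%VS.

Definition is_commutator (K : fieldType) (A : falgType K) (a : A) : Prop :=
  exists x y : A, a = x * y - y * x.

(* Main.v *)
(* If [f_s] are orthogonal idempotents summing to 1 with [f_s a f_s = 0] for all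
   [s], then [a = x y - y x] for [x = \sum_s l_s f_s] with distinct scalars
   [l_s] and [y = \sum_(s != t) (l_s - l_t)^-1 f_s a f_t]. A trace-zero matrix
   over a field of characteristic zero is similar to one with zero diagonal, so
   when [a] has multitrace zero, conjugates of the diagonal matrix units of the
   blocks give such a family for the component [b] of [a] in [B]. Each [f_s]
   lies in some [e_i B e_i], so [f_s (a - b) f_s] lies in [e_i rad(A) e_i], which
   vanishes for a generalized block-triangular algebra.
   Having multitrace zero does not depend on the decomposition: for any of them
   it amounts to being a commutator modulo the two-sided ideal [rad(A)]. *)
Require Import Defs.
From mathcomp Require Import all_boot all_algebra all_field.
From mathcomp Require Import boolp.

Set Implicit Arguments.
Unset Strict Implicit.
Unset Printing Implicit Defensive.

Import GRing.Theory.

Local Open Scope ring_scope.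

(** * Trace-zero matrices and zero diagonals *)

Section ZeroDiagonal.
Variable K : fieldType.

(** Basis vectors force the off-diagonal entries to vanish; sums of two basis vectors equate the
    diagonal entries. The multiplier in [v = c *: (v *m N)] is nonzero because [v] is. *)
Lemma is_scalar_mx_of_stable_rows n (N : 'M[K]_n) :
  (forall v : 'rV_n, (v <= v *m N)%MS) -> is_scalar_mx N.
Proof.
move=> stabN.
have Nrow i : exists c, forall j, (i == j)%:R = c * N i j.
  have /sub_rVP[c eqc] := stabN (delta_mx 0 i); exists c => j.
  by move/rowP/(_ j): eqc; rewrite -rowE !mxE eqxx eq_sym.
have offdiag i j : i != j -> N i j = 0.
  move=> neq; have [c eqc] := Nrow i.
  have := eqc j; rewrite (negPf neq) => /esym/eqP.
  rewrite mulf_eq0 => /orP[/eqP c0|/eqP //].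
  by have := eqc i; rewrite eqxx c0 mul0r => /eqP; rewrite oner_eq0.
have diag_eq i j : N i i = N j j.
  have [-> // | neq] := eqVneq i j.
  have /sub_rVP[c eqc] := stabN (delta_mx 0 i + delta_mx 0 j).
  have cNii : c * N i i = 1.
    move/rowP/(_ i): eqc; rewrite mulmxDl -!rowE !mxE !eqxx.
    by rewrite (negPf neq) (offdiag j i) 1?eq_sym // !addr0.
  have cNjj : c * N j j = 1.
    move/rowP/(_ j): eqc; rewrite mulmxDl -!rowE !mxE !eqxx [j == i]eq_sym.
    by rewrite (negPf neq) (offdiag i j) // !add0r.
  have c0 : c != 0.
    by apply/eqP => c0; move/eqP: cNii; rewrite c0 mul0r eq_sym oner_eq0.
  by apply: (mulfI c0); rewrite cNii cNjj.
case: n N offdiag diag_eq {stabN Nrow} => [|n] N offdiag diag_eq.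
  by apply/is_scalar_mxP; exists 0; apply/matrixP=> -[].
apply/is_scalar_mxP; exists (N 0 0); apply/matrixP=> i j; rewrite mxE.
by have [->|/offdiag->] := eqVneq i j; rewrite ?mulr1n // (diag_eq j 0).
Qed.

(** Since [v *m w = 1], the vector [v] spans a complement of the left kernel of [w]; a basis of that
    kernel supplies the other rows. The condition on [Q *m w] makes [w] the first column of the
    inverse of [Q]. *)
Lemma row_free_completion n (v : 'rV[K]_n.+1) (w : 'cV[K]_n.+1) :
  v *m w = 1%:M ->
  exists2 Q : 'M[K]_(1 + n), Q \in unitmx &
    usubmx Q = v /\ Q *m w = col_mx 1%:M 0.
Proof.
move=> vw1.
have rkw : \rank (kermx w) = n.
  rewrite mxrank_ker; suff -> : \rank w = 1%N by rewrite subn1.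
  apply/eqP; rewrite eqn_leq rank_leq_col /=.
  by rewrite -[X in (X <= _)%N](mxrank1 K 1) -vw1 mxrankM_maxr.
have [C freeC Cw0] : exists2 C : 'M[K]_(n, n.+1), row_free C & C *m w = 0.
  have := row_base_free (kermx w).
  have : row_base (kermx w) *m w = 0 by apply/sub_kermxP; rewrite eq_row_base.
  by move: (row_base _); rewrite rkw => C; exists C.
exists (col_mx v C).
  rewrite -row_free_unit -kermx_eq0 -submx0.
  set u := kermx _; have : u *m col_mx v C = 0 by apply: mulmx_ker.
  rewrite -[u]hsubmxK mul_row_col => uQ.
  (* Multiplying by [w] kills the rows of [C] and isolates the coefficient of [v]. *)
  have l0 : lsubmx u = 0.
    have := congr1 (mulmx^~ w) uQ.
    by rewrite mulmxDl -!mulmxA vw1 Cw0 mulmx0 addr0 mulmx1 mul0mx.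
  have r0 : rsubmx u = 0.
    by apply: (row_free_inj freeC); move: uQ; rewrite l0 !mul0mx add0r.
  by rewrite l0 r0 row_mx0 submx0.
by rewrite col_mxKu mul_col_mx vw1 Cw0.
Qed.

(** Induction on the size. If some [v] is outside the span of [v *m N], a basis starting with [v]
    puts a zero in the corner, and the remaining block still has trace zero. Otherwise [N] is
    scalar, hence zero in characteristic zero. *)
Lemma similar_zero_diag n (N : 'M[K]_n) :
  [pchar K] =i pred0 -> \tr N = 0 ->
  exists2 P : 'M[K]_n, P \in unitmx & forall k, (P *m N *m invmx P) k k = 0.
Proof.
move=> charK; elim: n N => [|n IHn] N trN0.
  by exists 1%:M => [|[]]; rewrite ?unitmx1.
have [[v]|/forallNP stabN] :=
  pselect (exists v : 'rV_n.+1, ~~ (v <= v *m N)%MS).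
  rewrite submxE => /matrix0Pn[i [j]]; rewrite ord1 => nz.
  set z := v *m _ in nz.
  (* A column of the cokernel is killed by [v *m N]; this one is not killed by [v], so it can be
     scaled to [v *m w = 1]. *)
  pose w := (z 0 j)^-1 *: col j (cokermx (v *m N)).
  have vw1 : v *m w = 1%:M.
    apply/matrixP=> i1 i2; rewrite !ord1 -scalemxAr colE mulmxA -/z -colE mxE.
    by rewrite [col _ _ _ _]mxE [in RHS]mxE mulVf.
  have vNw0 : v *m N *m w = 0.
    by rewrite -scalemxAr colE mulmxA mulmx_coker mul0mx scaler0.
  have [Q uQ [Qv Qw]] := row_free_completion vw1.
  pose M : 'M[K]_(1 + n) := Q *m N *m invmx Q.
  (* The corner equals [v *m N *m w], as [Q] starts with [v] and its inverse with [w]. *)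
  have M00 : ulsubmx M = 0.
    have : usubmx (M *m Q *m w) = 0.
      by rewrite -!mulmxA mulKmx // -mul_usub_mx Qv mulmxA.
    rewrite -mulmxA Qw -[M]submxK mul_block_col col_mxKu.
    by rewrite mulmx1 mulmx0 addr0 block_mxKul.
  have trM : \tr (drsubmx M) = 0.
    have : \tr M = 0 by rewrite mxtrace_mulC mulKmx.
    by rewrite -{1}[M]submxK mxtrace_block M00 mxtrace0 add0r.
  have [P uP P0] := IHn _ trM.
  pose R : 'M[K]_(1 + n) := block_mx 1%:M 0 0 P.
  pose R' : 'M[K]_(1 + n) := block_mx 1%:M 0 0 (invmx P).
  have RR' : R *m R' = 1%:M.
    rewrite mulmx_block !(mul0mx, mulmx0, mulmx1, addr0, add0r) mulmxV //.
    by rewrite -scalar_mx_block.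
  have [uR _] := mulmx1_unit RR'.
  have uRQ : R *m Q \in unitmx by rewrite unitmx_mul uR.
  exists (R *m Q) => // k.
  have -> : R *m Q *m N *m invmx (R *m Q) = R *m M *m R'.
    have -> : invmx (R *m Q) = invmx Q *m R'.
      apply: (can_inj (mulKmx uRQ)); rewrite mulmxV //.
      by rewrite -mulmxA mulKVmx.
    by rewrite !mulmxA.
  rewrite -[M]submxK M00 !mulmx_block.
  rewrite !(mul0mx, mulmx0, mulmx1, mul1mx, addr0, add0r).
  case: (@splitP 1 n k) => k' eqk.
    have -> : k = lshift n k' by apply: val_inj.
    by rewrite [LHS](block_mxEul _ _ _ _ k' k') mxE.
  have -> : k = rshift 1 k' by apply: val_inj.
  by rewrite [LHS](block_mxEdr _ _ _ _ k' k') P0.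
have /is_scalar_mxP[c Nc] : is_scalar_mx N.
  by apply: is_scalar_mx_of_stable_rows => v; apply/negPn/negP/stabN.
exists 1%:M => [|k]; first exact: unitmx1.
move: trN0; rewrite Nc mxtrace_scalar => /eqP.
rewrite -mulr_natr mulf_eq0 ((pcharf0P _).1 charK) orbF => /eqP->.
by rewrite raddf0 mulmx0 mul0mx mxE.
Qed.

End ZeroDiagonal.

(** * Commutators from orthogonal idempotents *)

Lemma commutator_of_zero_diag (K : fieldType) (A : falgType K) (I : finType)
    (f : I -> A) (a : A) :
    [pchar K] =i pred0 ->
    (forall s t, f s * f t = (s == t)%:R *: f s) -> \sum_s f s = 1 ->
    (forall s, f s * a * f s = 0) ->
  is_commutator a.
Proof.
move=> charK ff sumf faf.
(* Distinct natural numbers stay distinct in [K] by characteristic zero. *)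
pose l (s : I) : K := (enum_rank s)%:R.
have l_inj s t : l s = l t -> s = t.
  move=> /eqP eql; apply/enum_rank_inj/val_inj => /=.
  wlog le_st : s t eql / (enum_rank s <= enum_rank t)%N.
    move=> H; case/orP: (leq_total (enum_rank s) (enum_rank t)) => /H; first exact.
    by rewrite eq_sym => /(_ eql).
  apply/eqP; rewrite eqn_leq le_st /= -subn_eq0 -((pcharf0P _).1 charK).
  by rewrite natrB // subr_eq0 eq_sym.
pose x := \sum_s l s *: f s.
(* The terms with [s = t] vanish since [0^-1 = 0]. *)
pose y := \sum_s \sum_t (l s - l t)^-1 *: (f s * a * f t).
exists x, y.
have xf s : x * f s = l s *: f s.
  rewrite mulr_suml (bigD1 s) //= big1 => [|t /negPf neq].
    by rewrite -scalerAl ff eqxx scale1r addr0.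
  by rewrite -scalerAl ff neq scale0r scaler0.
have fx s : f s * x = l s *: f s.
  rewrite mulr_sumr (bigD1 s) //= big1 => [|t].
    by rewrite -scalerAr ff eqxx scale1r addr0.
  by rewrite eq_sym => /negPf neq; rewrite -scalerAr ff neq scale0r scaler0.
(* In this Peirce decomposition, commuting with [x] scales the [(s, t)] term by [l s - l t]. *)
have -> : a = \sum_s \sum_t f s * a * f t.
  under eq_bigr do rewrite -mulr_sumr sumf mulr1.
  by rewrite -mulr_suml sumf mul1r.
rewrite [x * y]mulr_sumr [y * x]mulr_suml -sumrB; apply: eq_bigr => s _.
rewrite mulr_sumr mulr_suml -sumrB; apply: eq_bigr => t _.
rewrite -scalerAr -scalerAl -scalerBr !mulrA xf -(mulrA _ (f t) x) fx.
rewrite -!scalerAl -scalerAr -scalerBl scalerA.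
have [<- | neq] := eqVneq s t; first by rewrite faf scaler0.
by rewrite mulVf ?scale1r // subr_eq0; apply: contra neq => /eqP/l_inj->.
Qed.

(** * The radical as a two-sided ideal *)

Section JacobsonIdeal.
Variables (K : fieldType) (A : falgType K).

Lemma jradMl (a x : A) : x \in jrad A -> a * x \in jrad A.
Proof.
move=> /jradP xJ; apply/jradP => M maxM; have [/prodvP lM _ _] := maxM.
by apply: lM; rewrite ?memvf // xJ.
Qed.

(* [{y | y * a \in M}] is either the whole algebra or again a maximal left
   ideal. *)
Lemma jradMr (x a : A) : x \in jrad A -> x * a \in jrad A.
Proof.
move=> /jradP xJ; apply/jradP => M [/prodvP lM Mproper maxM].
pose N := (amulr a @^-1: M)%VS.
have NE y : (y \in N) = (y * a \in M) by rewrite -memv_preim lfunE.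
suff [NT|maxN] : N = fullv \/ maximal_left_ideal N.
- by rewrite -NE NT memvf.
- by rewrite -NE xJ.
have [->|/eqP NT] := eqVneq N fullv; [by left|right].
split=> // [|N' /prodvP lN' sNN'].
  by apply/prodvP => u y _; rewrite !NE -mulrA => ?; rewrite lM ?memvf.
have [sN'N|/subvPn[y yN' yN]] := boolP (N' <= N)%VS.
  by left; apply/subv_anti; rewrite sN'N.
(* [S] contains [y * a], which is outside [M], so it is everything by maximality. Then
   [z * a = m + n * a] puts [z - n] in [N], hence [z] in [N']. *)
right; pose S := (M + amulr a @: N')%VS.
have lS : left_ideal S.
  apply/prodvP => u v _ /memv_addP[m mM [_ /memv_imgP[n nN' ->] ->]].
  rewrite lfunE /= mulrDr mulrA memv_add ?lM ?memvf //.
  by apply/memv_imgP; exists (u * n); rewrite ?lfunE ?lN' ?memvf.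
have [SM|ST] := maxM S lS (addvSl _ _).
  case/negP: yN; rewrite NE -SM; apply: (subvP (addvSr _ _)).
  by apply/memv_imgP; exists y; rewrite ?lfunE.
apply/subv_anti; rewrite subvf; apply/subvP => z _.
have : z * a \in S by rewrite ST memvf.
case/memv_addP=> m mM [_ /memv_imgP[n nN' ->]]; rewrite lfunE /= => eqz.
rewrite -(subrK n z) rpredD //; apply: (subvP sNN').
by rewrite NE mulrBl eqz addrK.
Qed.

End JacobsonIdeal.

(** * Semisimple components and multitraces *)

Section Component.
Variables (K : fieldType) (A : falgType K) (D : wedderburn_malcev A).
Implicit Types (a : A) (b : subvs_of (wm_B D)).

Lemma wm_componentP a : a - vsval (wm_component D a) \in jrad A.
Proof.
have capBJ := directv_addP (wm_direct D).
have aT : a \in (wm_B D + jrad A)%VS by rewrite wm_full memvf.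
rewrite /wm_component vsprojK ?memv_pi // -{1}(daddv_pi_add capBJ aT).
by rewrite addrC addKr memv_pi.
Qed.

(** Two candidates differ by an element of both summands of a direct sum. *)
Lemma wm_component_uniq a b : a - vsval b \in jrad A -> wm_component D a = b.
Proof.
move=> abJ; apply/subvs_inj/eqP; rewrite -subr_eq0 -memv0.
rewrite -(directv_addP (wm_direct D)) memv_cap memvB ?subvsP //=.
set c := wm_component D a.
have -> : vsval c - vsval b = (a - vsval b) - (a - vsval c).
  by rewrite opprB [RHS]addrC subrKA.
by rewrite rpredB // wm_componentP.
Qed.

Lemma wm_componentB x y :
  wm_component D (x - y) = wm_component D x - wm_component D y.
Proof. by rewrite /wm_component !raddfB. Qed.

Lemma wm_componentM x y :
  wm_component D (x * y) = wm_component D x * wm_component D y.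
Proof.
apply: wm_component_uniq => /=.
set u := vsval _; set v := vsval _.
have -> : x * y - u * v = (x - u) * y + u * (y - v).
  by rewrite mulrBl mulrBr addrA subrK.
by apply: rpredD; [apply: jradMr | apply: jradMl]; apply: wm_componentP.
Qed.

Lemma wm_isoM i b c : wm_iso i (b * c) = wm_iso i b *m wm_iso i c.
Proof. exact: rmorphM. Qed.

(** Taking components is multiplicative because the radical is two-sided, so each block of [a] is a
    commutator of matrices. *)
Lemma commutator_multitrace_zero a : is_commutator a -> multitrace_zero D a.
Proof.
move=> [x [y ->]] i; rewrite /multitrace wm_componentB !wm_componentM.
by rewrite !raddfB /= !wm_isoM mxtrace_mulC subrr.
Qed.

Lemma wm_iso_inj b c : (forall i, wm_iso i b = wm_iso i c) -> b = c.
Proof.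
move=> eqbc; rewrite -(wm_isoK b) -(wm_isoK c); congr wm_inv.
by apply/ffunP => i; rewrite !ffunE eqbc.
Qed.

Lemma vsval1 : vsval (1 : subvs_of (wm_B D)) = 1.
Proof. by apply/eqP; rewrite algid_eq1 wm_B1. Qed.

(** An index [s] is a block with a diagonal position in it. The last clause puts [f s] in the corner
    of its block, where triangularity applies. *)
Lemma multitrace_zero_idempotents a :
    [pchar K] =i pred0 -> multitrace_zero D a ->
  exists f : {i : 'I_(wm_r D) & 'I_(wm_d i)} -> A,
    [/\ forall s t, f s * f t = (s == t)%:R *: f s,
        \sum_s f s = 1,
        forall s, f s * vsval (wm_component D a) * f s = 0 &
        forall s, f s * wm_idem (tag s) = f s /\ wm_idem (tag s) * f s = f s].
Proof.
move=> charK tr0; set b := wm_component D a.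
have exP i : exists P : 'M[K]_(wm_d i), (P \in unitmx) /\
    forall k, (P *m wm_iso i b *m invmx P) k k = 0.
  by have [P] := similar_zero_diag charK (tr0 i); exists P.
have [P Pprop] := all_sig (fun i => cid (exP i)).
pose I := {i : 'I_(wm_r D) & 'I_(wm_d i)}.
(* A diagonal matrix unit in the block [tag s] and zero in the others; comparing in the sigma type
   avoids transport between blocks. *)
pose E (s : I) i : 'M[K]_(wm_d i) :=
  diag_mx (\row_k (Tagged (fun i => 'I_(wm_d i)) k == s)%:R).
pose g (s : I) := wm_inv [ffun i => invmx (P i) *m E s i *m P i].
have gE s i : wm_iso i (g s) = invmx (P i) *m E s i *m P i.
  by rewrite wm_invK ffunE.
have uP i : P i \in unitmx by case: (Pprop i).
have EE s t i : E s i *m E t i = (s == t)%:R *: E s i.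
  rewrite mulmx_diag -[RHS]linearZ; congr diag_mx; apply/rowP=> k; rewrite !mxE.
  have [<-|neq] := eqVneq s t; first by rewrite mul1r -natrM mulnb andbb.
  rewrite mul0r -natrM mulnb; case: eqP => // ->.
  by rewrite (negPf neq).
exists (fun s => vsval (g s)); split=> [s t||s|s].
- suff -> : vsval (g s) * vsval (g t) = vsval ((s == t)%:R *: g s).
    by rewrite linearZ.
  rewrite -[LHS]/(vsval (g s * g t)); congr vsval; apply: wm_iso_inj => i.
  rewrite wm_isoM linearZ /= !gE !mulmxA mulmxK //.
  by rewrite -(mulmxA _ (E s i)) EE -scalemxAr -scalemxAl.
- rewrite -raddf_sum -vsval1; congr vsval; apply: wm_iso_inj => i.
  rewrite raddf_sum rmorph1 /=; under eq_bigr do rewrite gE.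
  rewrite -mulmx_suml -mulmx_sumr.
  suff -> : \sum_s E s i = 1%:M by rewrite mulmx1 mulVmx.
  rewrite -raddf_sum -diag_const_mx; congr diag_mx; apply/rowP=> k.
  rewrite summxE mxE (bigD1 (Tagged _ k)) //= mxE eqxx big1 ?addr0 // => s.
  by rewrite mxE eq_sym => /negPf->.
- have -> : vsval (g s) * vsval b * vsval (g s) = vsval (g s * b * g s) by [].
  suff -> : g s * b * g s = 0 by [].
  apply: wm_iso_inj => i; rewrite raddf0 !wm_isoM gE.
  have [_ diag0] := Pprop i.
  (* Regrouping places the zero-diagonal conjugate of [b] between two copies of [E s i], which keep
     at most one diagonal entry. *)
  have -> : invmx (P i) *m E s i *m P i *m wm_iso i b
              *m (invmx (P i) *m E s i *m P i)
      = invmx (P i) *m (E s i *m (P i *m wm_iso i b *m invmx (P i)) *m E s i)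
              *m P i by rewrite !mulmxA.
  suff -> : E s i *m (P i *m wm_iso i b *m invmx (P i)) *m E s i = 0.
    by rewrite mulmx0 mul0mx.
  move: (P i *m _ *m _) diag0 => N diag0.
  rewrite mul_diag_mx mul_mx_diag; apply/matrixP=> k l; rewrite !mxE.
  case: eqP => [eqk|_]; last by rewrite !mul0r.
  case: eqP => [eql|_]; last by rewrite mulr0.
  move/eqP: eqk; rewrite -eql eq_Tagged => /eqP /= ->.
  by rewrite diag0 mulr0 mul0r.
have Eidem i : (i == tag s)%:R *: E s i = E s i.
  have [_|neq] := eqVneq i; first by rewrite scale1r.
  rewrite scale0r; apply/esym; rewrite -[RHS](raddf0 diag_mx).
  congr diag_mx; apply/rowP => k; rewrite !mxE.
  by case: eqP => // eqs; rewrite -eqs eqxx in neq.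
have isoE i : wm_iso i (wm_inv [ffun j => (j == tag s)%:R%:M])
    = (i == tag s)%:R%:M by rewrite wm_invK ffunE.
split; rewrite /wm_idem.
- rewrite -[LHS]/(vsval (g s * _)); congr vsval; apply: wm_iso_inj => i.
  by rewrite wm_isoM gE isoE mul_mx_scalar scalemxAl scalemxAr Eidem.
- rewrite -[LHS]/(vsval (_ * g s)); congr vsval; apply: wm_iso_inj => i.
  by rewrite wm_isoM gE isoE mul_scalar_mx scalemxAl scalemxAr Eidem.
Qed.

End Component.

Theorem theorem9 (K : closedFieldType) (charK0 : [pchar K] =i pred0)
    (A : falgType K) (gbtA : generalized_block_triangular A)
    (D : wedderburn_malcev A) (a : A) :
  is_commutator a <-> multitrace_zero D a.
Proof.
split=> [|trD]; first exact: commutator_multitrace_zero.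
have [D0 triD0] := gbtA.
(* The triangular decomposition [D0] may differ from [D]. The [D]-component of [a] is a commutator,
   so its [D0]-multitrace is zero; it agrees with [a] modulo the radical, so both have the same
   [D0]-component. *)
have trD0 : multitrace_zero D0 a.
  have [f [ff sumf fbf _]] := multitrace_zero_idempotents charK0 trD.
  have comm_b := commutator_of_zero_diag charK0 ff sumf fbf.
  move=> i; rewrite -(commutator_multitrace_zero comm_b i) /multitrace.
  congr (\tr (wm_iso i _)); apply: wm_component_uniq.
  rewrite -(subrKA (vsval (wm_component D a))).
  by rewrite rpredD ?wm_componentP.
have [f [ff sumf fbf fe]] := multitrace_zero_idempotents charK0 trD0.
apply: (commutator_of_zero_diag charK0 ff sumf) => s.
set b := vsval _ in fbf; rewrite -(subrK b a) mulrDr mulrDl fbf addr0.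
have [fe1 ef1] := fe s; rewrite -{1}fe1 -{2}ef1.
set e := wm_idem (tag s); set j := a - b.
(* Triangularity includes the diagonal blocks, so this element is zero. *)
have eje : e * j * e \in jrad_block (tag s) (tag s).
  by rewrite !memv_mul ?memv_line ?wm_componentP.
have -> : f s * e * j * (e * f s) = f s * (e * j * e) * f s by rewrite !mulrA.
by move: eje; rewrite triD0 // memv0 => /eqP->; rewrite mulr0 mul0r.
Qed.
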